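(* Let $G=(V,E)$ be a finite simple strongly connected directed graph, let $P$ be the transition probability matrix of an irreducible Markov chain associated with $G$, let $\mathcal{G}=(\mathcal{V},\mathcal{E})$ be the spanning tree graph of $G$, and let $\mathcal{P}$ be the lift of $P$ to $\mathcal{V}$. Let $R(s) := \zeta_G(s)/\zeta_{\mathcal{G}}(s)$ be the ratio of the stochastic zeta functions of $P$ and $\mathcal{P}$. Then $$R(s) = \prod_{W} \det\big((I - sP)^{(V \setminus W)}\big)^{m'(W)},$$ where the product ranges over all proper strongly connected subsets $W \subset V$, $(I-sP)^{(V\setminus W)}$ denotes the matrix $I-sP$ with the rows and columns corresponding to $V\setminus W$ removed, and the integers $m'(W)$ are defined recursively, for strongly connected $W\subseteq V$, by $$m'(W) := \begin{cases} 1, & W = V,\\ k(W) - \sum_{W' \supsetneq W} m'(W'), & W \neq V,\end{cases}$$ where the sum ranges over strongly connected subsets $W'$ of $V$ properly containing $W$ and $k(W)$ is the number of spanning forests of $G$ rooted in $W$.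
   Context: Simple means no loops and no multiple edges in $E$. A Markov chain on $V$ with transition matrix $P=(p(i,j))_{i,j\in V}$ is associated with $G$ if, for $i\ne j$, $p(i,j)>0$ iff $(i,j)\in E$; self-transition probabilities $p(i,i)\ge 0$ are allowed. A spanning tree of $G$ is a directed spanning tree rooted at some vertex, with all edges directed towards the root (every non-root vertex has exactly one outgoing edge in the tree, the root has none, and following outgoing edges from any vertex leads to the root). A spanning forest rooted in $W\subseteq V$ is a set of edges in which each vertex outside $W$ has exactly one outgoing edge, vertices of $W$ have none, and following outgoing edges from any vertex leads to a vertex of $W$ (so the set of roots is exactly $W$). The spanning tree graph $\mathcal{G}=(\mathcal{V},\mathcal{E})$: $\mathcal{V}$ is the set of spanning trees of $G$; for $t_i,t_j\in\mathcal{V}$ with roots $i$ and $j$ respectively, $(t_i,t_j)\in\mathcal{E}$ iff $t_j$ is obtained from $t_i$ by adding the edge $(i,j)$ and removing the outgoing edge from $j$. The lift $\mathcal{P}$ is the matrix indexed by $\mathcal{V}$ with $\mathcal{P}(t_i,t_j)=p(i,j)$ if $(t_i,t_j)\in\mathcal{E}$ (with $t_i$, $t_j$ rooted at $i$, $j$), $\mathcal{P}(t_i,t_i)=p(i,i)$ if $t_i$ has root $i$, and all other entries $0$. The stochastic zeta function of $P$ is $\zeta_G(s) := \exp\big(\sum_{n\ge1}\frac{s^n}{n}\sum_{c\in C_n}\mathrm{wt}(c)\big) = 1/\det(I-sP)$, where $C_n$ is the set of cycles $c=v_1\cdots v_n$ of length $n$ (sequences of vertices, repetitions and self-transitions allowed,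 with a designated starting vertex) and $\mathrm{wt}(c)=p(v_1,v_2)\cdots p(v_{n-1},v_n)p(v_n,v_1)$. $\zeta_{\mathcal{G}}(s)=1/\det(I-s\mathcal{P})$ is defined in the same way from $\mathcal{P}$ on $\mathcal{V}$. A subset $W\subseteq V$ is strongly connected if the subgraph of $G$ induced on $W$ is strongly connected (single vertices are strongly connected). The empty set may be included or omitted in the product: by convention the determinant of the empty matrix is $1$. *)

(* Defs.v *)
From HB Require Import structures.
From mathcomp Require Import all_boot all_order all_algebra.
From mathcomp Require Import all_classical all_reals all_analysis.
From mathcomp Require Import complex.

Set Implicit Arguments.
Unset Strict Implicit.
Unset Printing Implicit Defensive.

Import Order.TTheory GRing.Theory Num.Theory numFieldNormedType.Exports.

Local Open Scope ring_scope.

(* A simple digraph on V is a relation E : rel V, assumed irreflexive. *)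
Section Digraph.
Variables (V : finType) (E : rel V).

(* The induced subgraph on W is strongly connected; the empty set is excluded. *)
Definition strongly_connected (W : {set V}) : bool :=
  (W != finset.set0) &&
  [forall x in W, forall y in W,
     connect [rel a b | [&& a \in W, b \in W & E a b]] x y].

Definition spanning_forest (W : {set V}) (F : {set V * V}) : bool :=
  [&& [forall e in F, E e.1 e.2],
      [forall x, #|[set y | (x, y) \in F]| == (x \notin W)]
    & [forall x, [exists w in W, connect [rel a b | (a, b) \in F] x w]]].

Definition nforests (W : {set V}) : nat := #|[set F | spanning_forest W F]|.

(* A spanning tree is stored with its root, which its edge set determines. *)
Definition stree := {t : V * {set V * V} | spanning_forest [set t.1] t.2}.

HB.instance Definition _ := Finite.on stree.

Definition troot (t : stree) : V := (val t).1.
Definition tedges (t : stree) : {set V * V} := (val t).2.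

(* The condition E (troot t) (troot u) cannot be dropped: when the two roots
   coincide, adding and then removing the loop would give u = t. *)
Definition stree_edge : rel stree := fun t u =>
  E (troot t) (troot u) &&
  (tedges u == ((troot t, troot u) |: tedges t)
                 :\: [set e | e.1 == troot u]).

Definition lift_chain (R : nmodType) (p : V -> V -> R) (t u : stree) : R :=
  if stree_edge t u then p (troot t) (troot u)
  else if t == u then p (troot t) (troot t) else 0.

(* Recursion on the number n of vertices outside W. *)
Fixpoint mprime_rec (n : nat) (W : {set V}) : int :=
  if W == [set: V] then 1 else
  if n is n'.+1 then
    (nforests W)%:Z
    - \sum_(W' : {set V} | strongly_connected W' && (W \proper W'))
        mprime_rec n' W'
  else 0.

Definition mprime (W : {set V}) : int := mprime_rec #|~: W| W.

Lemma mprime_rec_stable n W : (#|~: W| <= n)%N -> mprime_rec n W = mprime W.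
Proof.
have full (A : {set V}) : (#|~: A| <= 0)%N -> A == [set: V].
  by rewrite leqn0 cards_eq0 -finset.setCT (inj_eq (@finset.setC_inj V)).
suff eq_rec m A : (#|~: A| <= m)%N -> forall k, (#|~: A| <= k)%N ->
    mprime_rec m A = mprime_rec k A.
  by move=> Wn; apply: eq_rec.
elim: m A => [|m IHm] A Am [|k] Ak; try by rewrite /= full.
rewrite /=; case: ifP => // _; congr (_ - _).
apply: eq_bigr => W' /andP[_ WW'].
have lt : (#|~: W'| < #|~: A|)%N by rewrite proper_card // finset.properC.
by apply: IHm; rewrite -ltnS (leq_trans lt).
Qed.

Lemma mprimeE W : mprime W =
  if W == [set: V] then 1
  else (nforests W)%:Z
       - \sum_(W' : {set V} | strongly_connected W' && (W \proper W'))
           mprime W'.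
Proof.
rewrite -(mprime_rec_stable (leqnSn _)) /=; case: ifP => // _; congr (_ - _).
apply: eq_bigr => W' /andP[_ WW']; apply: mprime_rec_stable.
by rewrite ltnW // proper_card // finset.properC.
Qed.

End Digraph.

Arguments lift_chain {V} E {R} p t u.

Section Chain.
Variables (R : numDomainType) (V : finType) (p : V -> V -> R).

Definition stochastic : Prop :=
  (forall x y, 0 <= p x y) /\ (forall x, \sum_y p x y = 1).

Fixpoint nstep (n : nat) (x y : V) : R :=
  if n is n'.+1 then \sum_z p x z * nstep n' z y else (x == y)%:R.

Definition irreducible : Prop := forall x y, exists n, 0 < nstep n x y.

Definition associated (E : rel V) : Prop :=
  forall x y, x != y -> (0 < p x y) = E x y.

End Chain.

Definition one_sub (K : pzRingType) (T : finType) (s : K) (p : T -> T -> K) :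
  T -> T -> K := fun x y => (x == y)%:R - s * p x y.

(* The matrix M with the rows and columns indexed by U removed. *)
Definition removed_mx (K : Type) (T : finType) (M : T -> T -> K) (U : {set T}) :
  'M[K]_#|~: U| := \matrix_(i, j) M (enum_val i) (enum_val j).

Definition forest_product (K : fieldType) (V : finType) (E : rel V)
    (s : K) (p : V -> V -> K) : K :=
  \prod_(W : {set V} | strongly_connected E W && (W \proper [set: V]))
    \det (removed_mx (one_sub s p) (~: W)) ^ mprime E W.

Definition cycle_weight (R : pzSemiRingType) (T : finType) (p : T -> T -> R)
    (n : nat) (c : n.-tuple T) : R :=
  \prod_(i < n) p (tnth c i) (tnth c (ordS i)).

(* R[i] gets its topology as the regular module R[i]^o. *)
Definition cexp (R : realType) (z : R[i]) : R[i] :=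
  limn (series (fun n => z ^+ n / n`!%:R : R[i]^o)).

(* The series starts at n = 1, hence the shift. *)
Definition zeta (R : realType) (T : finType) (p : T -> T -> R) (s : R[i]) :
    R[i] :=
  cexp (limn (series (fun n => s ^+ n.+1 / n.+1%:R
    * \sum_(c : n.+1.-tuple T) (cycle_weight p c)%:C%C : R[i]^o))).

Definition ratfun_const (R : idomainType) (a : R) : {fraction {poly R}} :=
  tofrac a%:P.

Definition ratfun_var (R : idomainType) : {fraction {poly R}} := tofrac 'X.

Arguments ratfun_var {R}.

(* The same function as an element of the field R(s), which continues it
   beyond the disc where the cycle series converges. *)
Definition zeta_ratfun (R : idomainType) (T : finType) (p : T -> T -> R) :
    {fraction {poly R}} :=
  (\det (removed_mx (one_sub ratfun_var (fun x y => ratfun_const (p x y)))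
                    finset.set0))^-1.

(* Main.v *)
Require Import Defs.
From mathcomp Require Import all_boot all_order all_algebra.
From mathcomp Require Import all_classical all_reals all_analysis.
From mathcomp Require Import complex.
From mathcomp Require Import ring lra.

Import Order.TTheory GRing.Theory Num.Theory.
Local Open Scope ring_scope.

Set Implicit Arguments.
Unset Strict Implicit.
Unset Printing Implicit Defensive.

(** Both zeta functions are exponentials of generating series of closed walks,
    so everything reduces to counting the closed walks of the lift.

    Along a walk of G the lift evolves deterministically: stepping from i to j
    turns the current tree into the one with the edge (i, j) added and the edge
    out of j deleted (reroot).  Hence a closed walk c of G lifts to a closed walk
    of the tree graph exactly for those starting trees that it fixes.  After c
    has been run, every vertex visited by c points to its successor at its last
    visit, and the other vertices keep their edges.  A tree is therefore fixed by
    c if and only if its edges out of the support W of c are these last exits,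
    and then the remaining edges form an arbitrary spanning forest rooted in W
    (card_trees_fixed).  So c has k(W) closed lifts.  As W is strongly connected,
    the recursion for m' says that k(W) is the sum of m'(W') over the strongly
    connected W' containing W (nforestsE).  Exchanging sums gives, for n > 0,

       tr(lift^n) = sum over W' of m'(W') tr(P_W'^n),

    P_W' being the restriction of P to W' (sum_nstep_lift_restrict).

    On the analytic side, exp(sum over n > 0 of s^n tr(A^n) / n) det(1 - s A) = 1
    as soon as |s| is less than the inverse of a bound on the absolute row sums
    of A (cvg_log_trace_series).  By Schur triangularization this reduces to
    exp(sum of z^n / n) (1 - z) = 1 for |z| < 1.  Along the segment from 0 to z
    the left-hand side has zero derivative, and the same argument identifies the
    exponential series with e^x (cos y + i sin y), which makes it multiplicative
    (constant_expC_mul).  Exponentiating the trace identity then gives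
    1 / zeta(lift) as the product of the det(1 - s P_W)^m'(W), the factor W = V
    being 1 / zeta(P).

    For the identity in R(s), zeta(lift) is also the inverse determinant of the
    lift when s is small, so the corresponding polynomial identity holds at
    infinitely many real s (tofrac_prodz). *)

(** * Rerooting spanning forests *)

Section Forests.
Import mathcomp.boot.finset.
Variables (V : finType) (E : rel V).
Implicit Types (i j x : V) (A W : {set V}) (F G : {set V * V}) (s : seq V).

Definition flow F : rel V := [rel a b | (a, b) \in F].

(** Stopping a walk at its first visit to A leaves only edges whose source is
    outside A, which is why deleting the edges out of A keeps A reachable. *)
Lemma connect_first_hit (e : rel V) (A : {pred V}) x y :
  connect e x y -> y \in A ->
  exists2 a, a \in A & connect [rel u v | (u \notin A) && e u v] x a.
Proof.
case/connectP=> s + ->; elim: s x => [|z s IHs] x /=.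
  by move=> _ xA; exists x.
case/andP=> exz zs lastA; have [xA|xA] := boolP (x \in A); first by exists x.
have [a aA za] := IHs _ zs lastA; exists a => //.
by apply: connect_trans za; apply: connect1; rewrite /= xA.
Qed.

(** The effect on the edge set of a tree rooted at i of one step of the lift
    to the root j; for i = j it fixes the trees rooted at i, so that the loops of
    the chain need no separate treatment. *)
Definition reroot F i j := ((i, j) |: F) :\: [set e | e.1 == j].

Fixpoint reroot_along F i s := if s is j :: s' then reroot_along (reroot F i j) j s' else F.

(** The part of F that a walk with support W never modifies. *)
Definition outside W F := [set e in F | e.1 \notin W].

Lemma in_reroot F i j x y : ((x, y) \in reroot F i j) =
  (x != j) && ((x == i) && (y == j) || ((x, y) \in F)).
Proof. by rewrite !inE xpair_eqE. Qed.

Lemma spanning_forestP W F :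
  reflect [/\ forall e, e \in F -> E e.1 e.2,
              forall x, #|[set y | (x, y) \in F]| = (x \notin W)
            & forall x, exists2 w, w \in W & connect (flow F) x w]
    (spanning_forest E W F).
Proof.
apply: (iffP and3P) => [[/forall_inP EF /forallP outF /forallP hitF]|[EF outF hitF]].
  by split=> // x; [exact/eqP/outF | have /exists_inP := hitF x].
split; first exact/forall_inP.
  by apply/forallP => x; apply/eqP.
by apply/forallP => x; apply/exists_inP.
Qed.

Lemma forest_root_out W F x y : spanning_forest E W F -> (x, y) \in F -> x \notin W.
Proof.
case/spanning_forestP=> _ /(_ x) + _ xyF; case: (x \in W) => //= /eqP.
by rewrite cards_eq0 => /eqP/setP/(_ y); rewrite !inE xyF.
Qed.

(** Rerooting is followed on forests rather than on trees: to close up a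
    forest rooted in the support W of a walk into a tree, the walk is run from
    that forest, absorbing the roots in W one after the other. *)
Lemma forest_reroot A F i j : i \in A -> (i == j) || E i j ->
  spanning_forest E A F -> spanning_forest E (j |: (A :\ i)) (reroot F i j).
Proof.
move=> iA ij FA; have outA := forest_root_out FA.
case/spanning_forestP: (FA) => EF outF hitF.
apply/spanning_forestP; split.
- case=> x y; rewrite in_reroot /= => /andP[xj /orP[/andP[/eqP xi /eqP yj]|/EF//]].
  by case/orP: ij => [/eqP ij|]; [rewrite xi ij eqxx in xj | rewrite xi yj].
- move=> x; rewrite !inE negb_or negb_and negbK.
  have [->|xj] /= := eqVneq x j.
    by apply: eq_card0 => y; rewrite !inE eqxx.
  case: (eqVneq x i) xj => [->|xi] xj /=.
    rewrite -[RHS](cards1 j); apply: eq_card => y.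
    rewrite !inE xpair_eqE eqxx /=; have [->|yj] := eqVneq y j.
      by rewrite xj.
    by apply/negbTE; apply/negP => /andP[_ /outA]; rewrite iA.
  by rewrite -outF; apply: eq_card => y; rewrite !inE xpair_eqE (negbTE xi) xj.
- move=> x; have [a aA xa] := hitF x.
  (* If the old path ends in i, the new edge (i, j) continues it to j. *)
  have [b bA xb] : exists2 b, b \in j |: (A :\ i) & connect (flow ((i, j) |: F)) x b.
    have xa' : connect (flow ((i, j) |: F)) x a.
      apply: connect_sub xa => u v uv; apply: connect1.
      by rewrite /flow /= inE [_ \in F]uv orbT.
    have [ai|ai] := eqVneq a i; last by exists a; rewrite // !inE ai aA orbT.
    exists j; first by rewrite setU11.
    apply: connect_trans xa' _; rewrite ai; apply: connect1.
    by rewrite /flow /= setU11.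
  have [c cA xc] := connect_first_hit xb bA; exists c => //.
  apply: connect_sub xc => u v /= /andP[uA uv]; apply: connect1.
  rewrite /flow /= in_reroot; move: uA uv.
  by rewrite !inE negb_or => /andP[-> _]; rewrite /flow /= !inE xpair_eqE.
Qed.

Lemma forest_reroot_along A F i s : i \in A -> path [rel a b | (a == b) || E a b] i s ->
  spanning_forest E A F ->
  spanning_forest E (last i s |: (A :\: [set x in i :: s])) (reroot_along F i s).
Proof.
elim: s A F i => [|j s IHs] A F i iA /=.
  rewrite (_ : _ |: _ = A) //; apply/setP => x; rewrite !inE.
  by have [->|] := eqVneq x i.
case/andP=> ij js FA; have jA : j \in j |: (A :\ i) by rewrite setU11.
have := IHs _ _ _ jA js (forest_reroot iA ij FA); congr (spanning_forest _ _ _).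
apply/setP => x; rewrite !inE; case: (x == last j s) => //=.
by case: (x == j); case: (x == i); rewrite ?andbF ?andbT.
Qed.

(** The edges produced by a walk do not depend on the initial edge set:
    they are the last exits from the visited vertices. *)
Lemma reroot_along_split F i s :
  reroot_along F i s = outside [set x in s] F :|: reroot_along set0 i s.
Proof.
elim: s F i => [|j s IHs] F i /=.
  by rewrite setU0; apply/setP => e; rewrite !inE andbT.
rewrite IHs [in RHS]IHs setUA; congr (_ :|: _); apply/setP => -[x y].
rewrite !inE /= !orbF.
by case: (x == j); case: (x \in s); rewrite ?andbF ?andbT // orbC.
Qed.

Lemma reroot_along0_source i s x y : (x, y) \in reroot_along set0 i s -> x \in i :: s.
Proof.
elim: s i => [|j s IHs] i /=; first by rewrite inE.
rewrite reroot_along_split inE => /orP[|/IHs]; last first.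
  by rewrite !inE orbC => ->; rewrite orbT.
rewrite !inE orbF /= => /andP[/andP[_ /andP[-> _]] _] //.
Qed.

Lemma forest_outside A W F : A \subset W ->
  spanning_forest E A F -> spanning_forest E W (outside W F).
Proof.
move=> AW /spanning_forestP[EF outF hitF]; apply/spanning_forestP; split.
- by move=> e; rewrite inE => /andP[/EF].
- move=> x; have [xW|xW] /= := boolP (x \in W).
    by apply: eq_card0 => y; rewrite !inE /= xW andbF.
  have -> : [set y | (x, y) \in outside W F] = [set y | (x, y) \in F].
    by apply/setP => y; rewrite !inE /= xW andbT.
  by rewrite outF (contra (fintype.subsetP AW x)).
- move=> x; have [a aA xa] := hitF x.
  have [w wW xw] := connect_first_hit xa (fintype.subsetP AW a aA); exists w => //.
  apply: connect_sub xw => u v /andP[uW uv]; apply: connect1.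
  by rewrite /flow /= inE uW andbT.
Qed.

Lemma outside_forest W F : spanning_forest E W F -> outside W F = F.
Proof.
move=> FW; apply/setP => -[x y]; rewrite inE; apply: andb_idr.
exact: forest_root_out FW.
Qed.

(** A tree fixed by the closed walk s consists of the last exits of s, which
    are forced, and of its edges out of the vertices that s misses.  The latter
    form a forest rooted in the support of s, and every such forest occurs: the
    walk s itself turns it into a tree. *)
Lemma card_trees_fixed i s : s != [::] -> last i s = i ->
  path [rel a b | (a == b) || E a b] i s ->
  #|[set F | spanning_forest E [set i] F && (F == reroot_along F i s)]|
    = nforests E [set x in s].
Proof.
move=> s0 lasti pis; set W := [set x in s]; set L := reroot_along set0 i s.
have iW : i \in W.
  have : last i s \in s by case: (s) s0 => [|j s' _]; rewrite ?eqxx //= mem_last.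
  by rewrite lasti inE.
have sourceL x y : (x, y) \in L -> x \in W.
  by move/reroot_along0_source; rewrite !inE => /predU1P[->|//]; rewrite inE in iW.
have outL G : spanning_forest E W G -> outside W (G :|: L) = G.
  move=> GW; rewrite -[RHS](outside_forest GW); apply/setP => -[x y]; rewrite !inE /=.
  have [/sourceL|_] := boolP ((x, y) \in L); last by rewrite orbF.
  by rewrite inE => -> /=; rewrite !andbF.
pose forests := [set F | spanning_forest E W F].
rewrite /nforests -(@card_in_imset _ _ (fun G => G :|: L) forests); last first.
  by move=> G H; rewrite !inE => /outL eG /outL eH /= GH; rewrite -eG GH eH.
congr #|pred_of_set _|; apply/setP => F; rewrite inE; apply/idP/imsetP.
  case/andP=> Fi /eqP FL; exists (outside W F); last by rewrite {1}FL reroot_along_split.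
  by rewrite inE; apply: forest_outside Fi; rewrite sub1set.
case=> G; rewrite inE => GW ->; rewrite [reroot_along _ _ _]reroot_along_split outL // eqxx andbT.
have := forest_reroot_along iW pis GW; rewrite reroot_along_split outside_forest // lasti.
congr (spanning_forest _ _ _); apply/setP => x; rewrite !inE.
by case: (x == i); case: (x \in s).
Qed.

Lemma nforestsT : nforests E [set: V] = 1%N.
Proof.
rewrite /nforests -(cards1 (set0 : {set V * V})); congr #|pred_of_set _|.
apply/setP => F; rewrite !inE; apply/idP/eqP => [FT|->].
  by apply/setP => -[x y]; rewrite inE; apply/negP => /(forest_root_out FT); rewrite inE.
apply/spanning_forestP; split=> [e|x|x]; first by rewrite inE.
  by rewrite inE; apply: eq_card0 => y; rewrite !inE.
by exists x; rewrite ?inE.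
Qed.

(** The defining recursion of m' solved for k(W), which also holds for W = V
    because the empty set is the only forest rooted in V. *)
Lemma nforestsE W : strongly_connected E W ->
  (nforests E W)%:Z
    = \sum_(W' : {set V} | strongly_connected E W' && (W \subset W')) mprime E W'.
Proof.
move=> scW; rewrite (bigD1 W) ?scW ?subxx //= mprimeE.
have eqW W' : (strongly_connected E W' && (W \subset W') && (W' != W))
  = (strongly_connected E W' && (W \proper W')).
  by rewrite properEneq eq_sym -andbA [(W \subset _) && _]andbC.
rewrite (eq_bigl _ _ eqW); case: eqP => [->|_]; last by rewrite addrC subrKC.
rewrite nforestsT big1 ?addr0 // => W' /andP[_ TW'].
by move: (TW') (proper_sub TW'); rewrite subTset => /[swap] /eqP->; rewrite properE subxx.
Qed.

End Forests.

(** * Closed walks and their lifts *)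

Section Walks.
Variable R : numDomainType.

Lemma sum_tuple_cons (T : finType) n (F : seq T -> R) :
  \sum_(c : n.+1.-tuple T) F c = \sum_x \sum_(s : n.-tuple T) F (x :: s).
Proof.
rewrite pair_bigA (reindex (fun xs : T * n.-tuple T => [tuple of xs.1 :: xs.2])) //.
exists (fun c => (thead c, [tuple of behead c])) => [[x s] _|c _] /=.
  by congr (_, _); apply: val_inj.
by rewrite -tuple_eta.
Qed.

Lemma sum_tuple0 (T : finType) (F : seq T -> R) :
  \sum_(c : 0.-tuple T) F c = F [::].
Proof.
rewrite (bigD1 [tuple]) //= big1 ?addr0 // => c.
by case/eqP; exact: tuple0.
Qed.

Variables (T : finType) (p : T -> T -> R).
Implicit Types (x y : T) (s : seq T).

Fixpoint walk_weight x s : R :=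
  if s is y :: s' then p x y * walk_weight y s' else 1.

Lemma nstepE n x y :
  nstep p n x y = \sum_(s : n.-tuple T) walk_weight x s * (last x s == y)%:R.
Proof.
elim: n x => [|n IHn] x /=.
  by rewrite (sum_tuple0 (fun s => walk_weight x s * (last x s == y)%:R)) mul1r.
rewrite (sum_tuple_cons _ (fun s => walk_weight x s * (last x s == y)%:R)) /=.
apply: eq_bigr => z _; rewrite IHn mulr_sumr; apply: eq_bigr => s _.
by rewrite mulrA.
Qed.

Lemma nstep_rcons n x y :
  nstep p n.+1 x y = \sum_(s : n.-tuple T) walk_weight x (rcons s y).
Proof.
elim: n x => [|n IHn] x.
  rewrite (sum_tuple0 (fun s => walk_weight x (rcons s y))) /= mulr1.
  rewrite (bigD1 y) //= eqxx mulr1 big1 ?addr0 // => z /negbTE->.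
  by rewrite mulr0.
rewrite (sum_tuple_cons _ (fun s => walk_weight x (rcons s y))).
rewrite [LHS]/=; apply: eq_bigr => z _.
by rewrite -[(\sum_z0 _)]/(nstep p n.+1 z y) IHn mulr_sumr.
Qed.

Lemma walk_weightE x0 x s :
  walk_weight x s
    = \prod_(i < size s) p (nth x0 (x :: s) i) (nth x0 s i).
Proof.
elim: s x => [|y s IHs] x /=; first by rewrite big_ord0.
by rewrite big_ord_recl IHs.
Qed.

Lemma cycle_weight_cons n x (s : n.-tuple T) :
  cycle_weight p [tuple of x :: s] = walk_weight x (rcons s x).
Proof.
have szr : size (rcons s x) = n.+1 by rewrite size_rcons size_tuple.
rewrite (walk_weightE x) szr; apply: eq_bigr => i _.
rewrite !(tnth_nth x) /=; congr (p _ _).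
  by rewrite -rcons_cons nth_rcons /= size_tuple ltn_ord.
rewrite nth_rcons size_tuple.
have := ltn_ord i; rewrite ltnS leq_eqVlt => /orP[/eqP->|lt_in].
  by rewrite ltnn eqxx modnn.
by rewrite lt_in modn_small.
Qed.

Lemma sum_cycle_weight n :
  \sum_(c : n.+1.-tuple T) cycle_weight p c = \sum_x nstep p n.+1 x x.
Proof.
under [RHS]eq_bigr do rewrite nstep_rcons.
pose F s := if s is x :: s' then walk_weight x (rcons s' x) else 0.
rewrite -(sum_tuple_cons _ F); apply: eq_bigr => c _.
by rewrite [c]tuple_eta cycle_weight_cons.
Qed.

(** P_W is kept as a kernel on the whole vertex set, so that the walks inside
    different W can be compared; its closed walks of positive length are those of
    p with support in W. *)
Definition restrict (W : {set T}) x y : R :=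
  if (x \in W) && (y \in W) then p x y else 0.

End Walks.

Lemma walk_weight_restrict (R : numDomainType) (T : finType) (p : T -> T -> R) W x s :
  walk_weight (restrict p W) x s =
    walk_weight p x s * ((s == [::]) || all (mem W) (x :: s))%:R.
Proof.
elim: s x => [|y s IHs] x /=; first by rewrite mulr1.
rewrite IHs /restrict; case: ifP => [/andP[-> yW]|]; last first.
  by rewrite andbA => ->; rewrite mul0r mulr0.
by rewrite /= yW; case: s {IHs} => [|z s] /=; rewrite mulrA.
Qed.

Section Lift.
Import mathcomp.boot.finset.
Variables (R : numDomainType) (V : finType) (E : rel V) (p : V -> V -> R).
Hypotheses (simpleE : irreflexive E) (p_ge0 : forall x y, 0 <= p x y).
Hypothesis assocp : associated p E.
Implicit Types (i j x : V) (W : {set V}) (F : {set V * V}) (t u : stree E).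

Lemma step_edge i j : p i j != 0 -> (i == j) || E i j.
Proof.
by move=> pij; have [//|ij] := eqVneq i j; rewrite -assocp // lt0r pij p_ge0.
Qed.

Lemma walk_weight_path i s :
  walk_weight p i s != 0 -> path [rel a b | (a == b) || E a b] i s.
Proof.
elim: s i => //= j s IHs i; rewrite mulf_eq0 negb_or => /andP[/step_edge-> /IHs].
exact.
Qed.

Lemma stree_forest t : spanning_forest E [set troot t] (tedges t).
Proof. exact: (valP t). Qed.

Lemma stree_eq t u : troot t = troot u -> tedges t = tedges u -> t = u.
Proof.
move=> rtu etu; apply: val_inj; move: rtu etu; rewrite /troot /tedges.
by case: (val t) (val u) => [? ?] [? ?] /= -> ->.
Qed.

Lemma reroot_root i F : spanning_forest E [set i] F -> reroot F i i = F.
Proof.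
move=> Fi; apply/setP => -[x y]; rewrite in_reroot.
have [->|xi] := eqVneq x i; last by [].
by apply/esym/negbTE/negP => /(forest_root_out Fi); rewrite set11.
Qed.

(** The lift without case distinction: a self-transition is a reroot that does
    nothing, and p vanishes on the other pairs of distinct vertices which are not
    edges. *)
Lemma lift_chainE t u :
  lift_chain E p t u = p (troot t) (troot u)
    * (tedges u == reroot (tedges t) (troot t) (troot u))%:R.
Proof.
rewrite /lift_chain /stree_edge -/(reroot (tedges t) (troot t) (troot u)).
have [rtu|rtu] := eqVneq (troot t) (troot u).
  rewrite -rtu simpleE /= reroot_root ?stree_forest //.
  have -> : (t == u) = (tedges u == tedges t).
    by apply/eqP/eqP => [->//|etu]; apply: stree_eq.
  by case: eqP; rewrite ?mulr1 ?mulr0.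
have [Etu|nEtu] /= := boolP (E _ _).
  case: eqP => _; first by rewrite mulr1.
  by case: eqP => [tu|_]; [rewrite tu eqxx in rtu | rewrite mulr0].
case: eqP => [tu|_]; first by rewrite tu eqxx in rtu.
have [->|/step_edge] := eqVneq (p (troot t) (troot u)) 0; first by rewrite mul0r.
by rewrite (negbTE rtu) (negbTE nEtu).
Qed.

(** For each j with p i j > 0 there is exactly one successor tree rooted at j, so
    a sum over successor trees is a sum over successor vertices. *)
Lemma sum_lift t (G : V -> {set V * V} -> R) :
  \sum_u lift_chain E p t u * G (troot u) (tedges u)
    = \sum_j p (troot t) j * G j (reroot (tedges t) (troot t) j).
Proof.
rewrite (partition_big (@troot V E) predT) //=; apply: eq_bigr => j _.
have [pj0|pj] := eqVneq (p (troot t) j) 0.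
  by rewrite pj0 mul0r big1 // => u /eqP uj; rewrite lift_chainE uj pj0 !mul0r.
have uP : spanning_forest E [set j] (reroot (tedges t) (troot t) j).
  have := forest_reroot (set11 _) (step_edge pj) (stree_forest t).
  by rewrite setDv setU0.
pose u : stree E := exist _ (j, reroot (tedges t) (troot t) j) uP.
rewrite (bigD1 u) //= big1 => [|z /andP[/eqP zj zu]].
  by rewrite addr0 lift_chainE eqxx mulr1.
rewrite lift_chainE zj (_ : _ == _ = false) ?mulr0 ?mul0r //.
by apply: contraNF zu => /eqP ez; apply/eqP/stree_eq.
Qed.

(** A walk of the chain determines its lift once the initial tree is chosen. *)
Lemma nstep_lift n t u :
  nstep (lift_chain E p) n t u = \sum_(s : n.-tuple V) walk_weight p (troot t) s
    * ((last (troot t) s == troot u)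
       && (tedges u == reroot_along (tedges t) (troot t) s))%:R.
Proof.
pose G i F s := walk_weight p i s
  * ((last i s == troot u) && (tedges u == reroot_along F i s))%:R.
rewrite -/(G (troot t) (tedges t) _).
elim: n t => [|n IHn] t.
  rewrite (sum_tuple0 (G (troot t) (tedges t))) /G /= mul1r; congr _%:R.
  congr nat_of_bool; apply/eqP/andP => [->|[/eqP rtu /eqP etu]] //.
  by apply: stree_eq.
rewrite (sum_tuple_cons _ (G (troot t) (tedges t))) /=.
under eq_bigr do rewrite IHn.
rewrite (sum_lift t (fun i F => \sum_(s : n.-tuple V) G i F s)).
apply: eq_bigr => j _; rewrite mulr_sumr; apply: eq_bigr => s _.
by rewrite /G /= mulrA.
Qed.

(** The closed lifts of a closed walk are the trees that it fixes. *)
Lemma sum_nstep_lift n :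
  \sum_t nstep (lift_chain E p) n.+1 t t
    = \sum_i \sum_(s : n.+1.-tuple V) walk_weight p i s * (last i s == i)%:R
        * (nforests E [set x in s])%:R.
Proof.
rewrite (partition_big (@troot V E) predT) //; apply: eq_bigr => i _.
under eq_bigr => t /eqP ti do rewrite nstep_lift ti.
rewrite exchange_big /=; apply: eq_bigr => s _.
have [/eqP lasti|_] := boolP (last i s == i); last first.
  by rewrite big1 ?mulr0 ?mul0r // => t _; rewrite mulr0.
have [->|wis] := eqVneq (walk_weight p i s) 0.
  by rewrite !mul0r big1 // => t _; rewrite mul0r.
rewrite mulr1 -mulr_sumr -natr_sum /=; congr (_ * _%:R).
rewrite -(card_trees_fixed (i := i)) ?walk_weight_path //; last by case: s {lasti wis} => -[].
set A := [set F | _]; transitivity #|[set t : stree E | (troot t == i) && (tedges t \in A)]|.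
  rewrite -sum1_card big_mkcond [RHS]big_mkcond; apply: eq_bigr => t _; rewrite !inE.
  have [ti|//] := eqVneq (troot t) i.
  by have := stree_forest t; rewrite ti => -> /=; case: eqP.
rewrite -(card_in_imset (f := @tedges V E)); last first.
  move=> t u; rewrite !inE => /andP[/eqP ti _] /andP[/eqP ui _].
  by apply: stree_eq; rewrite ti ui.
congr #|pred_of_set _|; apply/setP => F; apply/imsetP/idP => [[t]|FA].
  by rewrite inE => /andP[_ tA] ->.
have Fi : spanning_forest E [set i] F by move: FA; rewrite inE => /andP[].
pose t : stree E := exist _ (i, F) Fi.
by exists t; rewrite // inE eqxx.
Qed.

Lemma support_connected i s : walk_weight p i s != 0 -> last i s = i -> s != [::] ->
  strongly_connected E [set x in s].
Proof.
move=> wis lasti s0; set W := [set x in s].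
have iW : i \in W.
  have : last i s \in s by case: (s) s0 => [|j s' _]; rewrite ?eqxx //= mem_last.
  by rewrite lasti inE.
have Ws x : x \in i :: s -> x \in W.
  by rewrite [x \in W]inE in_cons => /predU1P[->|//]; rewrite inE in iW.
have pWis : path [rel a b | [&& a \in W, b \in W & (a == b) || E a b]] i s.
  have: all (mem W) (i :: s) by apply/allP.
  have := walk_weight_path wis; elim: (s) (i) => //= j s' IHs k /andP[kj js'] /and3P[kW jW s'W].
  by rewrite kW jW kj IHs ?js' //= jW.
pose eW := [rel a b | [&& a \in W, b \in W & E a b]].
have sub : subrel (connect [rel a b | [&& a \in W, b \in W & (a == b) || E a b]]) (connect eW).
  apply: connect_sub => a b /= /and3P[aW bW /predU1P[->|Eab]]; first exact: connect0.
  by apply: connect1; rewrite /= aW bW.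
rewrite /strongly_connected; apply/andP; split.
  by apply/set0Pn; exists i.
apply/forall_inP => x xW; apply/forall_inP => y yW; apply: sub.
have fromi z : z \in W -> connect [rel a b | [&& a \in W, b \in W & (a == b) || E a b]] i z.
  by rewrite inE => zs; apply: (path_connect pWis); rewrite inE zs orbT.
apply: connect_trans (fromi y yW); rewrite inE in xW.
move: pWis lasti; case/path.splitP: xW => s1 s2.
rewrite cat_path last_cat last_rcons => /andP[_ px] lastx.
by apply/connectP; exists s2.
Qed.

Lemma sum_nstep_restrict W n :
  \sum_i nstep (restrict p W) n.+1 i i
    = \sum_i \sum_(s : n.+1.-tuple V) walk_weight p i s * (last i s == i)%:R
        * ([set x in s] \subset W)%:R.
Proof.
apply: eq_bigr => i _; rewrite nstepE; apply: eq_bigr => s _.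
rewrite walk_weight_restrict mulrAC.
have [lasti|_] := eqVneq (last i s) i; last by rewrite !mulr0 !mul0r.
congr (_ * _%:R); congr nat_of_bool.
have s0 : (tval s == [::]) = false by case: s {lasti} => -[].
rewrite s0 /= -lasti andb_idl.
  apply/allP/fintype.subsetP => sW x; first by rewrite inE => /sW.
  by move=> xs; apply: sW; rewrite inE.
by move/allP; apply; case: (tval s) s0 => // j s' _; rewrite /= mem_last.
Qed.

(** A closed walk of non-zero weight has a strongly connected support, so that
    nforestsE writes its number of closed lifts as a sum of m'(W') over the W'
    that contain it; exchanging the sums collects the closed walks inside W'. *)
Lemma sum_nstep_lift_restrict n :
  \sum_t nstep (lift_chain E p) n.+1 t t
    = \sum_(W : {set V} | strongly_connected E W)
        (mprime E W)%:~R * \sum_i nstep (restrict p W) n.+1 i i.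
Proof.
rewrite sum_nstep_lift.
under [RHS]eq_bigr do rewrite sum_nstep_restrict mulr_sumr.
rewrite [RHS]exchange_big; apply: eq_bigr => i _.
under [RHS]eq_bigr do rewrite mulr_sumr.
rewrite [RHS]exchange_big; apply: eq_bigr => s _.
have [lasti|_] := eqVneq (last i s) i; last first.
  by rewrite mulr0 mul0r big1 // => W _; rewrite mul0r mulr0.
have [->|wis] := eqVneq (walk_weight p i s) 0.
  by rewrite !mul0r big1 // => W _; rewrite !mul0r mulr0.
have scs : strongly_connected E [set x in s].
  by apply: (support_connected wis lasti); case: s {lasti wis} => -[].
rewrite mulr1 pmulrn (nforestsE scs) rmorph_sum mulr_sumr big_mkcondr; apply: eq_bigr => W _.
by case: ifP => _; rewrite ?mulr1 ?mulr0 // mulrC.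
Qed.

End Lift.

(** * Real power series *)

Section PowerSeries.
Import numFieldNormedType.Exports.
Local Open Scope classical_set_scope.
Variable R : realType.
Implicit Types (c : R^nat) (t r K : R).

(** The left-hand side is at most (1 + r + ... + r^n) (1 - r). *)
Lemma mulrSn_expr_le r n : 0 <= r <= 1 -> n.+1%:R * r ^+ n * (1 - r) <= 1 - r ^+ n.+1.
Proof.
case/andP=> r0 r1; elim: n => [|n IHn]; first by rewrite expr0 expr1 !mul1r.
have rn0 : 0 <= r ^+ n.+1 by rewrite exprn_ge0.
have rn1 : r ^+ n.+1 <= 1 by rewrite exprn_ile1.
have -> : n.+2%:R = n.+1%:R + 1 :> R by rewrite -natr1.
have -> : (n.+1%:R + 1) * r ^+ n.+1 * (1 - r)
  = r * (n.+1%:R * r ^+ n * (1 - r)) + r ^+ n.+1 * (1 - r).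
  by rewrite exprS; ring.
have -> : r ^+ n.+2 = r * r ^+ n.+1 by rewrite exprS.
have : r * (n.+1%:R * r ^+ n * (1 - r)) <= r * (1 - r ^+ n.+1) by rewrite ler_wpM2l.
by nra.
Qed.

(** With |t| = r^2 |K| and bounded c_n K^n, the factor n + 1 is absorbed by
    one half of r^(2 n), since (n + 1) r^n is bounded by 1 / (1 - r). *)
Lemma is_cvg_pseries_diffs c K t :
  cvgn (pseries c K) -> `|t| < `|K| -> cvgn (pseries (pseries_diffs c) t).
Proof.
move=> cK tK; have K0 : 0 < `|K| by exact: le_lt_trans tK.
have [B [Breal /(_ (`|B| + 1))]] := cvg_series_bounded cK.
rewrite (le_lt_trans (ler_norm _)) ?ltrDl // => /(_ isT) cB.
set B1 := `|B| + 1 in cB; have B10 : 0 <= B1 by rewrite addr_ge0.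
have cB' n : `|c n| * `|K| ^+ n <= B1 by rewrite -normrX -normrM; exact: cB.
pose r := Num.sqrt (`|t| / `|K|).
have r0 : 0 <= r by exact: sqrtr_ge0.
have r2 : `|t| = r ^+ 2 * `|K|.
  by rewrite sqr_sqrtr ?divr_ge0 // divfK // gt_eqF.
have r1 : r < 1.
  by rewrite -sqrtr1 ltr_sqrt // ltr_pdivrMr // mul1r.
apply: normed_cvg; rewrite /normed_series_of /=.
apply: (@series_le_cvg _ _ (geometric (B1 / `|K| / (1 - r)) r)) => [n|n|n|] //=.
- by rewrite !mulr_ge0 ?invr_ge0 ?exprn_ge0 ?subr_ge0 // ltW.
- rewrite /pseries_diffs !normrM normrX r2 normr_nat exprMn.
  have -> : n.+1%:R * `|c n.+1| * ((r ^+ 2) ^+ n * `|K| ^+ n)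
     = (`|c n.+1| * `|K| ^+ n.+1) / `|K| * (n.+1%:R * r ^+ n) * r ^+ n.
    by rewrite -exprM mul2n -addnn exprD [`|K| ^+ n.+1]exprS; field; rewrite gt_eqF.
  rewrite ler_wpM2r ?exprn_ge0 //.
  apply: ler_pM; rewrite ?mulr_ge0 ?invr_ge0 ?exprn_ge0 //.
    by rewrite ler_wpM2r ?invr_ge0 //.
  rewrite -[leRHS]mul1r ler_pdivlMr ?subr_gt0 //.
  apply: le_trans (mulrSn_expr_le n _) _; first by rewrite r0 ltW.
  by rewrite gerBl exprn_ge0.
- by apply: is_cvg_geometric_series; rewrite ger0_norm.
Qed.

Lemma is_derive_pseries c K t : cvgn (pseries c K) -> `|t| < `|K| ->
  is_derive t 1 (fun t => limn (pseries c t)) (limn (pseries (pseries_diffs c) t)).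
Proof.
move=> cK tK.
(* Two intermediate radii, one for each differentiation. *)
pose K' n := `|t| + (`|K| - `|t|) * n%:R / 3.
have K'0 n : 0 <= K' n.
  by rewrite /K' addr_ge0 // !mulr_ge0 // ?subr_ge0 ?ltW.
have cK' : cvgn (pseries c (K' 2)).
  by apply: is_cvg_pseries_inside cK _; rewrite ger0_norm // /K'; lra.
have dK' : cvgn (pseries (pseries_diffs c) (K' 2)).
  by apply: is_cvg_pseries_diffs cK _; rewrite ger0_norm // /K'; lra.
apply: (@pseries_snd_diffs _ c (K' 1)).
- by apply: is_cvg_pseries_inside cK' _; rewrite !ger0_norm // /K'; lra.
- by apply: is_cvg_pseries_inside dK' _; rewrite !ger0_norm // /K'; lra.
- by apply: is_cvg_pseries_diffs dK' _; rewrite !ger0_norm // /K'; lra.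
- by rewrite [ltRHS]ger0_norm // /K'; lra.
Qed.

Lemma lim_pseries_at0 c : limn (pseries c 0) = c 0.
Proof.
apply: cvg_lim => //; rewrite -cvg_shiftS.
rewrite (_ : [sequence _]_n = fun=> c 0); first exact: cvg_cst.
apply/funext => n /=; rewrite /pseries /series /= big_nat_recl //= expr0 mulr1.
by rewrite big1 ?addr0 // => i _; rewrite exprS mul0r mulr0.
Qed.

End PowerSeries.

(** * The complex exponential and logarithmic series *)

Section ComplexExp.
Import numFieldNormedType.Exports.
Local Open Scope classical_set_scope.
Local Open Scope complex_scope.
Local Notation Re := complex.Re.
Local Notation Im := complex.Im.
Variable R : realType.
Implicit Types (c d : R^nat) (t K : R) (z w : R[i]).

Lemma normcRe z : (Re `|z|)%:C = `|z|.
Proof. by rewrite normc_def. Qed.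

Lemma le_normcRe z : `|Re z| <= Re `|z|.
Proof. by have := normc_ge_Re z; rewrite -normcRe lecR. Qed.

Lemma le_normcIm z : `|Im z| <= Re `|z|.
Proof.
by rewrite normc_def /= -sqrtr_sqr ler_wsqrtr // lerDr sqr_ge0.
Qed.

Lemma cvg_complex (u : nat -> R[i]) (a b : R) :
  (fun n => Re (u n)) @ \oo --> a -> (fun n => Im (u n)) @ \oo --> b ->
  (u : nat -> R[i]^o) @ \oo --> ((a +i* b) : R[i]^o).
Proof.
move=> /cvgrPdist_lt ua /cvgrPdist_lt ub; apply/cvgrPdist_lt => e e0.
have e2 : 0 < Re e / 2.
  by move: e0; case: e => er ei; rewrite ltcE /= => /andP[_ ?]; rewrite divr_gt0.
have -> : e = (Re e)%:C by rewrite RRe_real // gtr0_real.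
near=> n; have ran : `|a - Re (u n)| < Re e / 2 by near: n; exact: ua.
have rbn : `|b - Im (u n)| < Re e / 2 by near: n; exact: ub.
have -> : a +i* b - u n = (a - Re (u n))%:C + 'i * (b - Im (u n))%:C.
  case: (u n) => x y; rewrite mulrC; apply/eqP; rewrite eq_complex /=.
  by apply/andP; split; apply/eqP; ring.
apply: le_lt_trans (ler_normD _ _) _.
rewrite normrM normCi mul1r !normc_def /= expr0n /= !addr0 !sqrtr_sqr.
by rewrite -rmorphD ltcR [ltRHS](splitr (Re e)) ltrD.
Unshelve. all: by end_near. Qed.

(** The closed form of the exponential; its functional equation is that of the
    real exponential together with the addition formulas of cos and sin. *)
Definition expC z : R[i] := (expR (Re z) * cos (Im z)) +i* (expR (Re z) * sin (Im z)).

Lemma expC0 : expC 0 = 1.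
Proof. by rewrite /expC /= expR0 cos0 sin0 mulr1 mulr0. Qed.

Lemma expCD z w : expC (z + w) = expC z * expC w.
Proof.
case: z w => [x y] [x' y']; apply/eqP; rewrite eq_complex /= expRD cosD sinD.
by apply/andP; split; apply/eqP; ring.
Qed.

(** With w = u + i v and h = f + i g, the hypotheses say h' = - w' h, so the
    derivative of exp(w) h vanishes. *)
Lemma constant_expC_mul (u v f g u' v' : R -> R) :
  (forall t, 0 <= t <= 1 -> [/\ is_derive t 1 u (u' t), is_derive t 1 v (v' t),
      is_derive t 1 f (v' t * g t - u' t * f t)
    & is_derive t 1 g (- (u' t * g t + v' t * f t))]) ->
  expC (u 1 +i* v 1) * (f 1 +i* g 1) = expC (u 0 +i* v 0) * (f 0 +i* g 0).
Proof.
move=> duvfg.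
have cst (h : R -> R) : (forall t, 0 <= t <= 1 -> is_derive t 1 h 0) -> h 1 = h 0.
  move=> dh; have [||t _] := @MVT_segment R h (fun=> 0) 0 1 ler01.
  - by move=> t; rewrite in_itv /= => /andP[t0 t1]; apply: dh; rewrite !ltW.
  - apply: derivable_within_continuous => t; rewrite in_itv /= => t01.
    by have [] := dh t t01.
  by rewrite mul0r => /eqP; rewrite subr_eq0 => /eqP.
have dcos t : 0 <= t <= 1 -> is_derive t 1 (cos \o v) (- (v' t * sin (v t))).
  move=> /duvfg[_ dv _ _]; apply: (is_derive_eq (is_derive1_comp (is_derive_cos _) dv)).
  by rewrite mulNr mulrC.
have dsin t : 0 <= t <= 1 -> is_derive t 1 (sin \o v) (v' t * cos (v t)).
  move=> /duvfg[_ dv _ _]; apply: (is_derive_eq (is_derive1_comp (is_derive_sin _) dv)).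
  by rewrite mulrC.
have dexp t : 0 <= t <= 1 -> is_derive t 1 (expR \o u) (u' t * expR (u t)).
  move=> /duvfg[du _ _ _]; apply: (is_derive_eq (is_derive1_comp (is_derive_expR _) du)).
  by rewrite mulrC.
have dRe t : 0 <= t <= 1 ->
    is_derive t 1 ((expR \o u) * ((cos \o v) * f - (sin \o v) * g)) 0.
  move=> t01; have [du dv df dg] := duvfg t t01.
  have := dcos t t01; have := dsin t t01; have := dexp t t01 => de ds dc.
  apply: is_derive_eq; rewrite /GRing.scale /= !fctE /=; ring.
have dIm t : 0 <= t <= 1 ->
    is_derive t 1 ((expR \o u) * ((sin \o v) * f + (cos \o v) * g)) 0.
  move=> t01; have [du dv df dg] := duvfg t t01.
  have := dcos t t01; have := dsin t t01; have := dexp t t01 => de ds dc.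
  apply: is_derive_eq; rewrite /GRing.scale /= !fctE /=; ring.
have := cst _ dRe; have := cst _ dIm; rewrite !fctE /= => eIm eRe.
apply/eqP; rewrite eq_complex /=; apply/andP; split; apply/eqP.
  by rewrite -!mulrA -!mulrBr.
by rewrite -!mulrA -!mulrDr addrC eIm addrC.
Qed.

Lemma Re_exprS z n : Re (z ^+ n.+1) = Re z * Re (z ^+ n) - Im z * Im (z ^+ n).
Proof. by rewrite exprS; case: z (z ^+ n) => [x y] [x' y']. Qed.

Lemma Im_exprS z n : Im (z ^+ n.+1) = Re z * Im (z ^+ n) + Im z * Re (z ^+ n).
Proof. by rewrite exprS; case: z (z ^+ n) => [x y] [x' y']. Qed.

Lemma normcRe_exp z n : Re `|z ^+ n| = Re `|z| ^+ n.
Proof. by rewrite normrX -(normcRe z) -rmorphXn. Qed.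

Lemma normcRe_ge0 z : 0 <= Re `|z|.
Proof. exact: le_trans (le_normcRe z). Qed.

Lemma cvg_pseriesD c d x y t : cvgn (pseries c t) -> cvgn (pseries d t) ->
  pseries (fun n => x * c n + y * d n) t @ \oo
    --> x * limn (pseries c t) + y * limn (pseries d t).
Proof.
move=> ct dt; rewrite [X in X @ _](_ : _ = fun n => x * pseries c t n + y * pseries d t n).
  by apply: cvgD; apply: cvgMl_tmp.
apply/funext => n; rewrite /pseries /series /= !mulr_sumr -big_split /=.
by apply: eq_bigr => i _; rewrite mulrDl !mulrA.
Qed.

Lemma cvg_pseries_shift c t : cvgn (pseries (fun n => c n.+1) t) ->
  pseries c t @ \oo --> c 0%N + t * limn (pseries (fun n => c n.+1) t).
Proof.
move=> ct; rewrite -cvg_shiftS.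
rewrite [X in X @ _](_ : _ = fun n => c 0%N + t * pseries (fun n => c n.+1) t n).
  by apply: cvgD; [exact: cvg_cst | apply: cvgMl_tmp].
apply/funext => n; rewrite /pseries /series /= big_nat_recl //= expr0 mulr1.
by rewrite mulr_sumr; congr (_ + _); apply: eq_bigr => i _; rewrite exprS mulrCA.
Qed.

Lemma is_cvg_exp_pseries z (f : R[i] -> R) K : (forall w, `|f w| <= Re `|w|) ->
  cvgn (pseries (fun n => f (z ^+ n) / n`!%:R) K).
Proof.
move=> fw; apply: normed_cvg; rewrite /normed_series_of /=.
apply: (series_le_cvg _ _ _ (is_cvg_series_exp_coeff (Re `|z| * `|K|))) => n //=.
  by rewrite /exp_coeff /= divr_ge0 // exprn_ge0 // mulr_ge0 // normcRe_ge0.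
rewrite /exp_coeff /= !normrM normfV normr_nat normrX exprMn mulrAC.
rewrite ler_wpM2r ?invr_ge0 // ler_wpM2r ?exprn_ge0 //.
by rewrite -normcRe_exp.
Qed.

Lemma Re_divn z n : Re (z / n%:R) = Re z / n%:R.
Proof.
rewrite -(rmorph_nat (real_complex R)) -fmorphV.
by case: z => x y /=; rewrite mulr0 subr0.
Qed.

Lemma Im_divn z n : Im (z / n%:R) = Im z / n%:R.
Proof.
rewrite -(rmorph_nat (real_complex R)) -fmorphV.
by case: z => x y /=; rewrite mulr0 add0r.
Qed.

Lemma cvg_complex_series (u : nat -> R[i]) (a b : R) :
  series (fun n => Re (u n)) @ \oo --> a -> series (fun n => Im (u n)) @ \oo --> b ->
  series (u : nat -> R[i]^o) @ \oo --> ((a +i* b) : R[i]^o).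
Proof.
move=> ua ub; apply: cvg_complex.
  rewrite (_ : (fun n => _) = series (fun n => Re (u n))) //.
  by apply/funext => n; rewrite /series /= raddf_sum.
rewrite (_ : (fun n => _) = series (fun n => Im (u n))) //.
by apply/funext => n; rewrite /series /= raddf_sum.
Qed.

(** The series in t z solves h' = z h with h(0) = 1, so it is the inverse of
    expC(- t z) by constant_expC_mul, and that inverse is expC(t z). *)
Lemma cvg_exp_series z :
  series (fun n => z ^+ n / n`!%:R : R[i]^o) @ \oo --> (expC z : R[i]^o).
Proof.
pose a n := Re (z ^+ n) / n`!%:R; pose b n := Im (z ^+ n) / n`!%:R.
have ca t : cvgn (pseries a t) by apply: is_cvg_exp_pseries; exact: le_normcRe.
have cb t : cvgn (pseries b t) by apply: is_cvg_exp_pseries; exact: le_normcIm.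
pose F t := limn (pseries a t); pose G t := limn (pseries b t).
have diffs_fact (u : R) n : n.+1%:R * (u / n.+1`!%:R) = u / n`!%:R.
  by rewrite factS natrM invfM mulrCA mulVKf.
have dF t : is_derive t 1 F (Re z * F t + (- Im z) * G t).
  have t1 : `|t| < `|(`|t| + 1 : R)| by rewrite [ltRHS]ger0_norm ?ltrDl // addr_ge0.
  apply: (is_derive_eq (is_derive_pseries (ca _) t1)).
  rewrite (_ : pseries_diffs a = fun n => Re z * a n + (- Im z) * b n).
    by apply: cvg_lim => //; exact: cvg_pseriesD.
  apply/funext => n; rewrite /pseries_diffs diffs_fact Re_exprS /a /b.
  by rewrite mulrBl mulNr !mulrA.
have dG t : is_derive t 1 G (Re z * G t + Im z * F t).
  have t1 : `|t| < `|(`|t| + 1 : R)| by rewrite [ltRHS]ger0_norm ?ltrDl // addr_ge0.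
  apply: (is_derive_eq (is_derive_pseries (cb _) t1)).
  rewrite (_ : pseries_diffs b = fun n => Re z * b n + Im z * a n).
    by apply: cvg_lim => //; exact: cvg_pseriesD.
  apply/funext => n; rewrite /pseries_diffs diffs_fact Im_exprS /a /b.
  by rewrite mulrDl !mulrA.
have FG : F 1 +i* G 1 = expC z.
  have dlin (k : R) t : is_derive t 1 ( *%R k) k.
    by apply: is_derive_eq; rewrite /GRing.scale /= mulr1.
  have := @constant_expC_mul ( *%R (- Re z)) ( *%R (- Im z)) F G
    (fun=> - Re z) (fun=> - Im z) _.
  rewrite !mulr0 !mulr1 expC0 mul1r => expFG.
  rewrite -[LHS]mul1r -expC0 -[X in expC X](subrr z) expCD -mulrA.
  have -> : - z = - Re z +i* - Im z by case: (z).
  rewrite expFG; last first.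
    move=> t _; split=> //; first by apply: is_derive_eq (dF t) _; ring.
    by apply: is_derive_eq (dG t) _; ring.
  by rewrite /F /G !lim_pseries_at0 /a /b !expr0 /= mul0r divr1 mulr1.
rewrite -FG; apply: cvg_complex_series.
  rewrite (_ : (fun n => _) = fun n => a n * 1 ^+ n); first exact: ca.
  by apply/funext => n; rewrite expr1n mulr1 Re_divn.
rewrite (_ : (fun n => _) = fun n => b n * 1 ^+ n); first exact: cb.
by apply/funext => n; rewrite expr1n mulr1 Im_divn.
Qed.

Lemma cexpE z : cexp z = expC z.
Proof.
rewrite /cexp; exact: (cvg_lim (@norm_hausdorff _ R[i]^o) (@cvg_exp_series z)).
Qed.

Lemma cexpD z w : cexp (z + w) = cexp z * cexp w.
Proof. by rewrite !cexpE expCD. Qed.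

Lemma cexp0 : cexp 0 = 1 :> R[i].
Proof. by rewrite cexpE expC0. Qed.

Lemma is_cvg_log_pseries z (f : R[i] -> R) K : (forall w, `|f w| <= Re `|w|) ->
  Re `|z| * `|K| < 1 -> cvgn (pseries (fun n => f (z ^+ n) / n%:R) K).
Proof.
move=> fw zK; apply: normed_cvg; rewrite /normed_series_of /=.
have zK0 : 0 <= Re `|z| * `|K| by rewrite mulr_ge0 // normcRe_ge0.
apply: (@series_le_cvg _ _ (geometric 1 (Re `|z| * `|K|))) => [n|n|n|] //=.
- by rewrite mul1r exprn_ge0.
- rewrite mul1r !normrM normfV normr_nat normrX exprMn.
  rewrite ler_wpM2r ?exprn_ge0 // -normcRe_exp.
  apply: le_trans (fw _); case: n => [|n]; first by rewrite invr0 mulr0.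
  by rewrite ler_pdivrMr // ler_peMr // ler1n.
- by apply: is_cvg_geometric_series; rewrite ger0_norm.
Qed.

(** The logarithmic series in t z has the derivative z / (1 - t z), so its
    exponential times 1 - t z is constant on [0, 1], with the value 1 at 0. *)
Lemma cvg_log_series z : `|z| < 1 ->
  exists2 l : R[i], series (fun n => z ^+ n.+1 / n.+1%:R : R[i]^o) @ \oo --> (l : R[i]^o)
    & cexp l * (1 - z) = 1.
Proof.
rewrite -normcRe => /[!ltcR] z1; have z0 := normcRe_ge0 z.
set rho := Re `|z| in z1 z0.
pose a n := Re (z ^+ n) / n%:R; pose b n := Im (z ^+ n) / n%:R.
(* Any K > 1 with K |z| < 1 makes the power series differentiable on [0, 1]. *)
pose K : R := 2 / (1 + rho).
have K1 : 1 < K by rewrite ltr_pdivlMr; lra.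
have zK : Re `|z| * `|K| < 1.
  by rewrite [`|K|]ger0_norm ?(ltW (lt_trans ltr01 K1)) // mulrA ltr_pdivrMr -/rho; lra.
have ca : cvgn (pseries a K) by apply: is_cvg_log_pseries; [exact: le_normcRe|].
have cb : cvgn (pseries b K) by apply: is_cvg_log_pseries; [exact: le_normcIm|].
have tK t : 0 <= t <= 1 -> `|t| < `|K|.
  by case/andP=> t0 t1; rewrite !ger0_norm //; lra.
pose u t := limn (pseries a t); pose v t := limn (pseries b t).
pose u' t := limn (pseries (pseries_diffs a) t).
pose v' t := limn (pseries (pseries_diffs b) t).
have Ea : pseries_diffs a = fun n => Re (z ^+ n.+1).
  by apply/funext => n; rewrite /pseries_diffs /a mulrC divfK ?pnatr_eq0.
have Eb : pseries_diffs b = fun n => Im (z ^+ n.+1).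
  by apply/funext => n; rewrite /pseries_diffs /b mulrC divfK ?pnatr_eq0.
(* The next two facts are the real and imaginary parts of w' = z + t z w'. *)
have Eu' t : 0 <= t <= 1 -> u' t = Re z + t * (Re z * u' t + (- Im z) * v' t).
  move=> t01; have cda := is_cvg_pseries_diffs ca (tK t t01).
  have cdb := is_cvg_pseries_diffs cb (tK t t01).
  have cu := cvg_pseriesD (x := Re z) (y := - Im z) cda cdb.
  rewrite -/(u' t) -/(v' t) in cu.
  have E : (fun n => Re z * pseries_diffs a n + (- Im z) * pseries_diffs b n)
    = fun n => pseries_diffs a n.+1.
    by apply/funext => n; rewrite Ea Eb [RHS]Re_exprS mulNr.
  rewrite E in cu; rewrite -(cvg_lim _ cu) //.
  rewrite {1}/u'; apply: cvg_lim => //.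
  by have := cvg_pseries_shift (cvgP _ cu); rewrite {2}Ea expr1.
have Ev' t : 0 <= t <= 1 -> v' t = Im z + t * (Re z * v' t + Im z * u' t).
  move=> t01; have cda := is_cvg_pseries_diffs ca (tK t t01).
  have cdb := is_cvg_pseries_diffs cb (tK t t01).
  have cu := cvg_pseriesD (x := Re z) (y := Im z) cdb cda.
  rewrite -/(u' t) -/(v' t) in cu.
  have E : (fun n => Re z * pseries_diffs b n + Im z * pseries_diffs a n)
    = fun n => pseries_diffs b n.+1.
    by apply/funext => n; rewrite Ea Eb [RHS]Im_exprS.
  rewrite E in cu; rewrite -(cvg_lim _ cu) //.
  rewrite {1}/v'; apply: cvg_lim => //.
  by have := cvg_pseries_shift (cvgP _ cu); rewrite {2}Eb expr1.
exists (u 1 +i* v 1).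
  have one01 : 0 <= (1 : R) <= 1 by rewrite ler01 lexx.
  have c1 := is_cvg_pseries_inside ca (tK 1 one01).
  have d1 := is_cvg_pseries_inside cb (tK 1 one01).
  apply: cvg_complex_series.
    (* The term of index 0 of the power series vanishes, as the inverse of 0 is 0. *)
    rewrite (_ : series _ = [sequence pseries a 1 n.+1]_n) ?cvg_shiftS //.
    apply/funext => n; rewrite /pseries /series /= big_nat_recl //.
    rewrite /a invr0 mulr0 mul0r add0r; apply: eq_bigr => i _.
    by rewrite expr1n mulr1 Re_divn.
  rewrite (_ : series _ = [sequence pseries b 1 n.+1]_n) ?cvg_shiftS //.
  apply/funext => n; rewrite /pseries /series /= big_nat_recl //.
  rewrite /b invr0 mulr0 mul0r add0r; apply: eq_bigr => i _.
  by rewrite expr1n mulr1 Im_divn.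
have -> : 1 - z = (1 - 1 * Re z) +i* (- (1 * Im z)).
  by rewrite !mul1r; case: (z) => x y; apply/eqP; rewrite eq_complex /= sub0r !eqxx.
have d1 (k t : R) : is_derive t 1 (fun t => 1 - t * k) (- k).
  by apply: is_derive_eq; rewrite /GRing.scale /= ; ring.
have d2 (k t : R) : is_derive t 1 (fun t => - (t * k)) (- k).
  by apply: is_derive_eq; rewrite /GRing.scale /= ; ring.
rewrite cexpE (@constant_expC_mul u v (fun t => 1 - t * Re z) (fun t => - (t * Im z)) u' v').
  by rewrite /u /v !lim_pseries_at0 /a /b !invr0 !mulr0 expC0 mul1r !mul0r subr0 oppr0.
move=> t t01; split.
- exact: is_derive_pseries ca (tK t t01).
- exact: is_derive_pseries cb (tK t t01).
- apply: is_derive_eq (d1 _ _) _. have := Eu' t t01; lra.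
- apply: is_derive_eq (d2 _ _) _. have := Ev' t t01; lra.
Qed.

End ComplexExp.

(** * Traces, determinants and eigenvalues *)

Section Spectrum.
Variable C : numClosedFieldType.

Lemma trig_mulmx m (A B : 'M[C]_m) : is_trig_mx A -> is_trig_mx B ->
  is_trig_mx (A *m B) /\ forall i, (A *m B) i i = A i i * B i i.
Proof.
move=> /is_trig_mxP A0 /is_trig_mxP B0; split.
  apply/is_trig_mxP => i j ij; rewrite mxE big1 // => k _.
  have [ik|ki] := ltnP i k; first by rewrite A0 ?mul0r.
  by rewrite B0 ?mulr0 // (leq_ltn_trans ki).
move=> i; rewrite mxE (bigD1 i) //= big1 ?addr0 // => k ki.
have [ik|ik] := ltnP i k; first by rewrite A0 ?mul0r.
by rewrite B0 ?mulr0 // ltn_neqAle ki.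
Qed.

Lemma trig_exprmx m (A : 'M[C]_m) n : is_trig_mx A ->
  is_trig_mx (A ^+ n) /\ forall i, (A ^+ n) i i = A i i ^+ n.
Proof.
move=> trigA; elim: n => [|n [trigAn An]].
  rewrite expr0; split=> [|i]; last by rewrite mxE eqxx.
  exact: scalar_mx_is_trig.
have [trigAS AS] := trig_mulmx trigA trigAn; rewrite exprS; split=> // i.
by rewrite [LHS]AS An exprS.
Qed.

(** The d i are the diagonal entries of a triangular matrix similar to A. *)
Lemma mx_spectrum m (A : 'M[C]_m) : exists d : 'I_m -> C,
  [/\ forall i, eigenvalue A (d i), forall n, \tr (A ^+ n) = \sum_i d i ^+ n
    & forall s, \det (1%:M - s *: A) = \prod_i (1 - s * d i)].
Proof.
have [|P Pu] := @cotrigonalization C m [:: A].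
  by move=> B B'; rewrite !inE => /eqP-> /eqP->.
rewrite /= andbT; rewrite /similar_to => trigT; set T := conjmx P A in trigT.
have Puu : P \in unitmx by exact: unitarymx_unit.
have subT a : eigenvalue T a -> eigenvalue A a.
  by apply: eigenvalue_conjmx; rewrite ?row_free_unit ?stablemx_unit.
have TE : T = P *m A *m invmx P by rewrite /T conjumx.
clearbody T.
have TX n : T ^+ n = P *m (A ^+ n) *m invmx P.
  elim: n => [|n IHn]; first by rewrite !expr0 mulmx1 mulmxV.
  rewrite !exprS IHn TE -[_ * _]/(_ *m _) -[A * _]/(A *m _).
  by rewrite -!mulmxA mulKmx.
have trT B : \tr (P *m B *m invmx P) = \tr B.
  by rewrite mxtrace_mulC mulmxA mulVmx // mul1mx.
exists (fun i => T i i); split=> [i|n|s].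
- apply: subT; rewrite eigenvalue_root_char char_poly_trig // rootE horner_prod.
  by rewrite (bigD1 i) //= hornerXsubC subrr mul0r.
- rewrite -trT -TX /mxtrace; apply: eq_bigr => i _.
  by have [_ ->] := trig_exprmx n trigT.
- have -> : \det (1%:M - s *: A) = \det (1%:M - s *: T).
    rewrite TE; have -> : 1%:M - s *: (P *m A *m invmx P) = P *m (1%:M - s *: A) *m invmx P.
      by rewrite mulmxBr mulmxBl mulmx1 mulmxV // -scalemxAr -scalemxAl.
    by rewrite !det_mulmx mulrAC -det_mulmx mulmxV // det1 mul1r.
  rewrite det_trig; first by apply: eq_bigr => i _; rewrite !mxE eqxx.
  apply/is_trig_mxP => i j ij; move/is_trig_mxP: trigT => /(_ i j ij) T0.
  by rewrite !mxE T0 mulr0 subr0 -val_eqE /= ltn_eqF.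
Qed.

(** For a row eigenvector v, compare the 1-norms of a v and v A. *)
Lemma eigenvalue_norm_le m (A : 'M[C]_m) (M : C) a :
  (forall i, \sum_j `|A i j| <= M) -> eigenvalue A a -> `|a| <= M.
Proof.
move=> AM /eigenvalueP[v vA v0].
have v1 : 0 < \sum_j `|v 0 j|.
  rewrite lt_neqAle sumr_ge0 // andbT eq_sym psumr_neq0 //.
  move: v0; apply: contraR => /hasPn v0; apply/eqP/rowP => j; rewrite mxE.
  by apply/eqP; rewrite -normr_le0 real_leNgt ?v0 ?mem_index_enum //=.
rewrite -(ler_pM2r v1) mulr_sumr.
have -> : \sum_j `|a| * `|v 0 j| = \sum_j `|\sum_i v 0 i * A i j|.
  apply: eq_bigr => j _; rewrite -normrM; congr `|_|.
  by move/rowP: vA => /(_ j); rewrite !mxE => <-.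
apply: le_trans (ler_sum _ (fun j _ => ler_norm_sum _ _ _)) _.
rewrite exchange_big mulr_sumr; apply: ler_sum => i _ /=.
under eq_bigr do rewrite normrM.
by rewrite -mulr_sumr mulrC ler_wpM2r.
Qed.

End Spectrum.

Section LogTrace.
Import numFieldNormedType.Exports.
Local Open Scope classical_set_scope.
Variable R : realType.
Local Notation C := R[i].

Lemma cvg_series_sum (I : finType) (P : pred I) (u : I -> nat -> C) (l : I -> C) :
  (forall i, P i -> series (u i : nat -> C^o) @ \oo --> (l i : C^o)) ->
  series (fun n => \sum_(i | P i) u i n : C^o) @ \oo --> (\sum_(i | P i) l i : C^o).
Proof.
move=> ul; rewrite (_ : series _ = fun n => \sum_(i | P i) series (u i) n).
  by apply: cvg_big => [|i]; [exact: add_continuous | exact: ul].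
by apply/funext => n; rewrite /series /= exchange_big.
Qed.

Lemma cvg_seriesM (k : C) (u : nat -> C) (l : C) :
  series (u : nat -> C^o) @ \oo --> (l : C^o) ->
  series (fun n => k * u n : C^o) @ \oo --> (k * l : C^o).
Proof.
move=> ul; rewrite (_ : series _ = fun n => k * series u n).
  exact: cvgMl_tmp ul.
by apply/funext => n; rewrite /series /= mulr_sumr.
Qed.

Lemma cexp_sum (I : finType) (P : pred I) (l : I -> C) :
  cexp (\sum_(i | P i) l i) = \prod_(i | P i) cexp (l i).
Proof. by rewrite (big_morph _ (@cexpD R) (cexp0 R)). Qed.

(** This is the product of cvg_log_series over the eigenvalues of s A, which
    the bound on the row sums puts inside the unit disc. *)
Lemma cvg_log_trace_series m (A : 'M[C]_m) (s M : C) :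
  (forall i, \sum_j `|A i j| <= M) -> `|s| * M < 1 ->
  exists2 l : C,
    series (fun n => s ^+ n.+1 / n.+1%:R * \tr (A ^+ n.+1) : C^o) @ \oo --> (l : C^o)
    & cexp l * \det (1%:M - s *: A) = 1.
Proof.
move=> AM sM; have [d [dA trA detA]] := mx_spectrum A.
have sd i : `|s * d i| < 1.
  by rewrite normrM (le_lt_trans _ sM) // ler_wpM2l // (eigenvalue_norm_le AM).
pose l i := sval (cid2 (cvg_log_series (sd i))).
exists (\sum_i l i).
  rewrite (_ : (fun n => _) = fun n => \sum_i (s * d i) ^+ n.+1 / n.+1%:R).
    by apply: cvg_series_sum => i _; rewrite /l; case: cid2.
  apply/funext => n; rewrite trA mulr_sumr; apply: eq_bigr => i _.
  by rewrite exprMn mulrAC.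
rewrite detA cexp_sum -big_split big1 // => i _.
by rewrite /l; case: cid2.
Qed.

End LogTrace.

(** * Zeta functions as inverse determinants *)

Section RemovedDet.
Import numFieldNormedType.Exports.
Import mathcomp.boot.finset.

Lemma removed_one_subE (K : pzRingType) (T : finType) (s : K) (p : T -> T -> K)
    (U : {set T}) :
  removed_mx (one_sub s p) U = 1%:M - s *: removed_mx p U.
Proof. by apply/matrixP => i j; rewrite !mxE /one_sub (inj_eq enum_val_inj). Qed.

Lemma rmorph_removed_det (K K' : comNzRingType) (f : {rmorphism K -> K'})
    (T : finType) (s : K) (p : T -> T -> K) (U : {set T}) :
  f (\det (removed_mx (one_sub s p) U))
    = \det (removed_mx (one_sub (f s) (fun x y => f (p x y))) U).
Proof.
rewrite -det_map_mx; congr (\det _); apply/matrixP => i j.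
by rewrite !mxE rmorphB rmorphM rmorph_nat.
Qed.

(** Walks of the submatrix are walks of p that stay outside U. *)
Lemma removed_mx_exp (R : numDomainType) (T : finType) (p : T -> T -> R)
    (U : {set T}) n i j :
  (removed_mx p U ^+ n) i j
    = nstep (restrict p (~: U)) n (enum_val i) (enum_val j).
Proof.
elim: n i => [|n IHn] i; first by rewrite expr0 mxE /= (inj_eq enum_val_inj).
rewrite exprS mxE /= (bigID (mem (~: U))) /= [X in _ + X]big1 ?addr0 => [|z zU].
  rewrite (big_enum_val (fun z => restrict p (~: U) (enum_val i) z
    * nstep (restrict p (~: U)) n z (enum_val j))).
  by apply: eq_bigr => k _; rewrite mxE IHn /restrict !enum_valP.
by rewrite /restrict (negbTE zU) andbF mul0r.
Qed.

Lemma tr_removed_mx_exp (R : numDomainType) (T : finType) (p : T -> T -> R)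
    (U : {set T}) n :
  \tr (removed_mx p U ^+ n.+1) = \sum_i nstep (restrict p (~: U)) n.+1 i i.
Proof.
rewrite (bigID (mem (~: U))) /= [X in _ + X]big1 ?addr0 => [|z zU].
  rewrite (big_enum_val (fun z => nstep (restrict p (~: U)) n.+1 z z)).
  by apply: eq_bigr => i _; rewrite removed_mx_exp.
by rewrite big1 // => y _; rewrite /restrict (negbTE zU) mul0r.
Qed.

Lemma restrictT (R : numDomainType) (T : finType) (p : T -> T -> R) :
  restrict p [set: T] = p.
Proof. by apply/funext => x; apply/funext => y; rewrite /restrict !inE. Qed.

Lemma zeta_log_series (R : realType) (T : finType) (p : T -> T -> R) (s : R[i]) :
  zeta p s = cexp (limn (series (fun n => s ^+ n.+1 / n.+1%:R
    * (\sum_x nstep p n.+1 x x)%:C%C) : nat -> R[i]^o)).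
Proof.
suff E n : (\sum_(c : n.+1.-tuple T) (cycle_weight p c)%:C%C : R[i])
    = (\sum_x nstep p n.+1 x x)%:C%C.
  by rewrite /zeta; under eq_fun do rewrite E.
by rewrite -sum_cycle_weight rmorph_sum.
Qed.

Lemma lim_regular (R : realType) (u : nat -> R[i]) (l : R[i]) :
  ((u : nat -> R[i]^o) @ \oo --> (l : R[i]^o))%classic -> limn (u : nat -> R[i]^o) = l.
Proof. exact: (cvg_lim (@norm_hausdorff _ R[i]^o)). Qed.

Lemma cvg_restrict_log_series (R : realType) (T : finType) (p : T -> T -> R)
    (U : {set T}) (s : R[i]) (M : R) :
  (forall x, \sum_y `|p x y| <= M) -> `|s| * M%:C%C < 1 ->
  exists2 l : R[i],
    (series (fun n => s ^+ n.+1 / n.+1%:R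
       * (\sum_x nstep (restrict p (~: U)) n.+1 x x)%:C%C : R[i]^o) @ \oo
       --> (l : R[i]^o))%classic
    & cexp l * \det (removed_mx (one_sub s (fun x y => (p x y)%:C%C)) U) = 1.
Proof.
move=> pM sM; pose A := map_mx (real_complex R) (removed_mx p U).
have AM i : \sum_j `|A i j| <= M%:C%C.
  apply: le_trans (_ : (\sum_j `|removed_mx p U i j|)%:C%C <= _).
    rewrite rmorph_sum; apply: ler_sum => j _.
    by rewrite mxE normc_def /= expr0n addr0 sqrtr_sqr.
  rewrite lecR; apply: le_trans (pM (enum_val i)).
  under eq_bigr do rewrite mxE.
  rewrite -(big_enum_val (fun y => `|p (enum_val i) y|)) /=.
  by rewrite [leRHS](bigID (mem (~: U))) /= lerDl sumr_ge0.
have [l cvgl detl] := cvg_log_trace_series AM sM; exists l; last first.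
  rewrite -[RHS]detl removed_one_subE; congr (_ * \det (_ - _ *: _)).
  by apply/matrixP => i j; rewrite !mxE.
rewrite (_ : (fun n => _) = fun n => s ^+ n.+1 / n.+1%:R * \tr (A ^+ n.+1)) //.
apply/funext => n; congr (_ * _).
by rewrite -tr_removed_mx_exp /A -rmorphXn trace_map_mx.
Qed.

Lemma zeta_det (R : realType) (T : finType) (p : T -> T -> R) (s : R[i]) (M : R) :
  (forall x, \sum_y `|p x y| <= M) -> `|s| * M%:C%C < 1 ->
  zeta p s * \det (removed_mx (one_sub s (fun x y => (p x y)%:C%C)) set0) = 1.
Proof.
move=> pM sM; have [l + <-] := cvg_restrict_log_series set0 pM sM.
have -> : restrict p (~: set0) = p by rewrite setC0 restrictT.
move=> cvgl; rewrite zeta_log_series; congr (cexp _ * _).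
exact: lim_regular cvgl.
Qed.

Lemma cexp_mulrz (R : realType) (z : R[i]) (m : int) : cexp (z *~ m) = cexp z ^ m.
Proof.
have cexpMn n : cexp (z *+ n) = cexp z ^+ n.
  by elim: n => [|n IHn]; rewrite ?cexp0 // mulrS cexpD IHn exprS.
case: m => n; first exact: cexpMn.
rewrite NegzE mulrNz -exprnN -[LHS]mul1r.
have e1 : cexp (z *+ n.+1) * cexp (- (z *+ n.+1)) = 1 by rewrite -cexpD subrr cexp0.
have e0 : cexp (z *+ n.+1) != 0 by apply: contra_eq_neq e1 => ->; rewrite mul0r eq_sym oner_eq0.
by apply: (mulfI e0); rewrite mul1r e1 cexpMn mulfV // -cexpMn.
Qed.

Section Lift.
Variables (R : realType) (V : finType) (E : rel V) (p : V -> V -> R).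
Hypotheses (simpleE : irreflexive E) (stochp : stochastic p).
Hypothesis assocp : associated p E.

Lemma stochastic_row_sum x : \sum_y `|p x y| <= 1.
Proof.
have [p_ge0 p_sum] := stochp; rewrite -(p_sum x).
by apply: ler_sum => y _; rewrite ger0_norm.
Qed.

(** Multiplying the trace identity by s^n / n and summing turns it, after
    exponentiation, into a product of determinants. *)
Lemma zeta_lift (s : R[i]) : `|s| < 1 ->
  zeta (lift_chain E p) s
    = \prod_(W : {set V} | strongly_connected E W)
        \det (removed_mx (one_sub s (fun x y => (p x y)%:C%C)) (~: W))
          ^ (- mprime E W).
Proof.
move=> s1; have [p_ge0 _] := stochp.
have sM : `|s| * (1 : R)%:C%C < 1 by rewrite mulr1.
pose l W := sval (cid2 (cvg_restrict_log_series (~: W) stochastic_row_sum sM)).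
have cvg_lift : (series (fun n => s ^+ n.+1 / n.+1%:R
       * (\sum_t nstep (lift_chain E p) n.+1 t t)%:C%C : R[i]^o) @ \oo
    --> (\sum_(W : {set V} | strongly_connected E W) l W *~ mprime E W : R[i]^o))%classic.
  rewrite (_ : (fun n => _) = fun n => \sum_(W : {set V} | strongly_connected E W)
      (mprime E W)%:~R * (s ^+ n.+1 / n.+1%:R
        * (\sum_x nstep (restrict p W) n.+1 x x)%:C%C)).
    apply: cvg_series_sum => W _; rewrite -[l W *~ _]mulrzl.
    apply: cvg_seriesM; rewrite /l; case: cid2 => lW + _ /=.
    by rewrite setCK.
  apply/funext => n; rewrite sum_nstep_lift_restrict // rmorph_sum mulr_sumr.
  by apply: eq_bigr => W _; rewrite rmorphM rmorph_int mulrCA.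
rewrite zeta_log_series (lim_regular cvg_lift) cexp_sum.
apply: eq_bigr => W _; rewrite cexp_mulrz /l; case: cid2 => lW _ /= dW.
rewrite -exprz_inv; congr (_ ^ _).
have d0 : \det (removed_mx (one_sub s (fun x y => (p x y)%:C%C)) (~: W)) != 0.
  by apply: contra_eq_neq dW => ->; rewrite mulr0 eq_sym oner_eq0.
by apply: (mulIf d0); rewrite dW mulVf.
Qed.

End Lift.
End RemovedDet.

(** * From analytic to rational functions *)

Section RationalFunctions.
Variable R : realFieldType.

Lemma eq_poly_near0 (P Q : {poly R}) (e : R) : 0 < e ->
  (forall r, 0 < r < e -> P.[r] = Q.[r]) -> P = Q.
Proof.
move=> e0 PQ; apply/eqP; rewrite -subr_eq0; apply/contraT => PQ0.
pose rs := [seq e / n.+2%:R | n <- iota 0 (size (P - Q))].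
have := max_poly_roots (p := P - Q) (rs := rs) PQ0.
rewrite size_map size_iota ltnn => -> //.
  apply/allP => _ /mapP[n _ ->]; rewrite rootE !hornerE PQ ?subrr //.
  by rewrite divr_gt0 //= ltr_pdivrMr // ltr_pMr // ltr1n.
rewrite map_inj_uniq ?iota_uniq // => n m /(mulfI (lt0r_neq0 e0)) /invr_inj /eqP.
by rewrite eqr_nat => /eqP[].
Qed.

(** Splits an integer exponent into natural ones, so that an identity between
    rational functions becomes one between polynomials. *)
Definition pos_part (m : int) : nat := if m is Posz n then n else 0.

Lemma exprz_pos_neg (K : fieldType) (x : K) m : x != 0 ->
  x ^ m = x ^+ pos_part m / x ^+ pos_part (- m).
Proof.
case: m => [[|n]|n] x0; rewrite ?NegzE ?opprK /= ?divr1 //.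
by rewrite mul1r.
Qed.

(** After clearing the negative exponents, both sides are polynomials that
    agree on an interval. *)
Lemma tofrac_prodz (I : finType) (P : pred I) (D : {poly R}) (F : I -> {poly R})
    (m : I -> int) (e : R) :
  0 < e -> (forall i, F i != 0) ->
  (forall r, 0 < r < e -> (forall i, P i -> (F i).[r] != 0)
     /\ D.[r] = \prod_(i | P i) (F i).[r] ^ m i) ->
  tofrac D = \prod_(i | P i) tofrac (F i) ^ m i.
Proof.
move=> e0 F0 DF.
have tF0 i : tofrac (F i) != 0 by rewrite tofrac_eq0.
under eq_bigr do rewrite exprz_pos_neg //.
rewrite big_split /= prodfV.
under eq_bigr do rewrite -rmorphXn.
under [X in _ / X]eq_bigr do rewrite -rmorphXn.
rewrite -!rmorph_prod; apply: (canRL (mulfK _)).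
  by rewrite tofrac_eq0; apply/prodf_neq0 => i _; rewrite expf_neq0.
rewrite -rmorphM; congr (tofrac _); apply: (eq_poly_near0 e0) => r re.
have [Fr0 DFr] := DF r re; rewrite hornerM DFr !horner_prod.
rewrite -big_split /=; apply: eq_bigr => i Pi.
by rewrite exprz_pos_neg ?Fr0 // !horner_exp divfK // expf_neq0 // Fr0.
Qed.

End RationalFunctions.

Section Main.
Import mathcomp.boot.finset.
Variables (R : realType) (V : finType) (E : rel V) (p : V -> V -> R).
Hypotheses (simpleE : irreflexive E) (stochp : stochastic p).
Hypothesis assocp : associated p E.
Hypothesis connE : strongly_connected E [set: V].
Local Open Scope complex_scope.

Definition det_poly (T : finType) (q : T -> T -> R) (U : {set T}) : {poly R} :=
  \det (removed_mx (one_sub 'X (fun x y => (q x y)%:P)) U).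

Lemma horner_det_poly (T : finType) (q : T -> T -> R) U (r : R) :
  (det_poly q U).[r] = \det (removed_mx (one_sub r q) U).
Proof.
rewrite -horner_evalE rmorph_removed_det; congr (\det (removed_mx (one_sub _ _) _)).
  by rewrite /= /horner_eval hornerX.
by apply/funext => x; apply/funext => y; rewrite /= /horner_eval hornerC.
Qed.

Lemma tofrac_det_poly (T : finType) (q : T -> T -> R) U :
  tofrac (det_poly q U)
    = \det (removed_mx (one_sub ratfun_var (fun x y => ratfun_const (q x y))) U).
Proof. by rewrite rmorph_removed_det. Qed.

Lemma det_poly_neq0 (T : finType) (q : T -> T -> R) U : det_poly q U != 0.
Proof.
apply/eqP => dp0; have := horner_det_poly q U 0.
rewrite dp0 horner0 removed_one_subE scale0r subr0 det1 => /eqP.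
by rewrite eq_sym oner_eq0.
Qed.

Lemma real_complex_det (T : finType) (q : T -> T -> R) U (r : R) :
  (\det (removed_mx (one_sub r q) U))%:C
    = \det (removed_mx (one_sub r%:C (fun x y => (q x y)%:C)) U).
Proof. exact: (rmorph_removed_det (real_complex R)). Qed.

Lemma det_stochastic_neq0 (s : R[i]) U : `|s| < 1 ->
  \det (removed_mx (one_sub s (fun x y => (p x y)%:C)) U) != 0.
Proof.
move=> s1; have sM : `|s| * (1 : R)%:C < 1 by rewrite mulr1.
have [l _ dl] := cvg_restrict_log_series U (stochastic_row_sum stochp) sM.
by apply: contra_eq_neq dl => ->; rewrite mulr0 eq_sym oner_eq0.
Qed.

Lemma prod_mprime_split (K : fieldType) (F : {set V} -> K) :
  \prod_(W : {set V} | strongly_connected E W) F W ^ mprime E W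
    = F [set: V] * \prod_(W : {set V} | strongly_connected E W && (W \proper [set: V]))
        F W ^ mprime E W.
Proof.
rewrite (bigD1 [set: V]) //= mprimeE eqxx expr1z; congr (_ * _).
by apply: eq_bigl => W; rewrite properT.
Qed.

Lemma zeta_ratio (s : R[i]) : `|s| < 1 ->
  zeta p s / zeta (lift_chain E p) s
    = forest_product E s (fun x y => (p x y)%:C).
Proof.
move=> s1; have sM : `|s| * (1 : R)%:C < 1 by rewrite mulr1.
rewrite zeta_lift // -prodfV.
under eq_bigr do rewrite invr_expz opprK.
rewrite prod_mprime_split mulrA setCT.
by rewrite (zeta_det (stochastic_row_sum stochp) sM) mul1r.
Qed.

(** For small real s both zeta_lift and zeta_det apply to the lift,
    whatever its row sums, which gives the determinant identity at infinitely
    many points. *)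
Lemma zeta_ratfun_ratio :
  zeta_ratfun p / zeta_ratfun (lift_chain E p)
    = forest_product E ratfun_var (fun x y => ratfun_const (p x y)).
Proof.
rewrite /zeta_ratfun /forest_product invrK -!tofrac_det_poly.
under eq_bigr do rewrite -tofrac_det_poly.
have tp0 : tofrac (det_poly p set0) != 0 by rewrite tofrac_eq0 det_poly_neq0.
apply: (mulfI tp0); rewrite mulVKf //.
rewrite -[X in tofrac (det_poly p X)]setCT.
rewrite -(prod_mprime_split (fun W => tofrac (det_poly p (~: W)))).
pose M := \sum_t \sum_u `|lift_chain E p t u|.
have M0 : 0 <= M by apply: sumr_ge0 => t _; apply: sumr_ge0.
have liftM t : \sum_u `|lift_chain E p t u| <= M.
  by rewrite /M [leRHS](bigD1 t) //= lerDl; apply: sumr_ge0 => z _; apply: sumr_ge0.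
apply: (tofrac_prodz (e := (M + 1)^-1)) => [||r /andP[r0 rM]].
- by rewrite invr_gt0 ltr_wpDl.
- by move=> W; exact: det_poly_neq0.
have rM1 : r * (M + 1) < 1 by rewrite -ltr_pdivlMr ?div1r // ltr_wpDl.
have rM0 : 0 <= r * M by rewrite mulr_ge0 // ltW.
have nr : `|r%:C| = r%:C by rewrite ger0_norm // lecR ltW.
have r1 : `|r%:C| < 1 by rewrite nr ltcR; nra.
have rMC : `|r%:C| * M%:C < 1 by rewrite nr -rmorphM ltcR; nra.
split=> [W _|].
  by rewrite horner_det_poly -(inj_eq (@complexI R)) real_complex_det det_stochastic_neq0.
apply: (@complexI R); rewrite horner_det_poly real_complex_det rmorph_prod /=.
under [RHS]eq_bigr do rewrite fmorphXz /= horner_det_poly real_complex_det.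
set Q := \prod_(W | _) _.
have Q0 : Q != 0.
  by apply/prodf_neq0 => W _; rewrite expfz_neq0 // det_stochastic_neq0.
apply: (mulfI (invr_neq0 Q0)); rewrite mulVf // -(zeta_det liftM rMC) zeta_lift //.
congr (_ * _); rewrite -prodfV; apply: eq_bigr => W _.
by rewrite invr_expz.
Qed.

End Main.

Theorem theorem3p1 (R : realType) (V : finType) (E : rel V) (p : V -> V -> R)
    (simpleE : irreflexive E)
    (connE : strongly_connected E [set: V])
    (stochp : stochastic p)
    (irrp : irreducible p)
    (assocp : associated p E) :
  (forall s : R[i], `|s| < 1 ->
     zeta p s / zeta (lift_chain E p) s
     = forest_product E s (fun x y => (p x y)%:C%C))
  /\
  zeta_ratfun p / zeta_ratfun (lift_chain E p)
  = forest_product E ratfun_var (fun x y => ratfun_const (p x y)).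
Proof.
by split=> [s|]; [exact: zeta_ratio | exact: zeta_ratfun_ratio].
Qed.
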